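(* Let $H$ be a finite-dimensional Hopf algebra over $\Bbbk$ and let $\mathcal{C}=H\text{-}\mathsf{mod}$ be the category of finite-dimensional left $H$-modules, with distinguished grouplike elements $\alpha_H\in G(H^* )$ and $g_H\in G(H)$. Then $\mathcal{C}$ is spherical (in the sense of Douglas–Schommer-Pries–Snyder) if and only if $\alpha_H=\varepsilon$ and $$\mathsf{SPiv}(H):=\big\{a\in G(H)\;\big|\;a^2=g_H,\ S^2(h)=aha^{-1}\text{ for all }h\in H\big\}\neq\varnothing.$$ In this case, there is a bijection between pivotal structures $j$ on $\mathcal{C}$ such that $(\mathcal{C},j)$ is spherical and the set $\mathsf{SPiv}(H)$.
   Context: $\Bbbk$ is an algebraically closed field. $G(H)$ and $G(H^* )$ denote grouplike elements; $\varepsilon$ and $S$ are the counit and antipode of $H$. The distinguished grouplike elements are characterized by: $\Lambda h=\alpha_H(h)\Lambda$ for all $h\in H$, where $\Lambda$ is a non-zero left integral of $H$; and $p\lambda=p(g_H)\lambda$ for all $p\in H^*$, where $\lambda$ is a non-zero right integral of $H^*$. A pivotal structure on $\mathcal{C}$ is a natural isomorphism $j_X\colon X\to X^{**}$ (left duals) with $j_{X\otimes Y}=j_X\otimes j_Y$. For $\mathcal{C}=H\text{-}\mathsf{mod}$, the distinguished invertible object is the one-dimensional module $D=\Bbbk v$ with $h\cdot v=\alpha_H^{-1}(h)v$, and the Radford isomorphism $\xi_D(X)\colon D\otimes X\to X^{4*}\otimes D$ is $\xi_D(X)(v\otimes x)=g_H\cdot x\otimes v$ (identifying the vector spaces $X^{4*}$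 and $X$). A pivotal finite tensor category $(\mathcal{C},j)$ is spherical if there is an isomorphism $\nu\colon\mathbf 1\to D$ such that $\xi_D(X)(\nu\otimes\mathsf{Id}_X)=(\mathsf{Id}_{X^{4*}}\otimes\nu)\,j_X^{**}\,j_X$ for all $X\in\mathcal{C}$. ''$\mathcal{C}$ is spherical'' means that it admits a pivotal structure $j$ for which $(\mathcal{C},j)$ is spherical. *)

(* Defs.v *)
From HB Require Import structures.
From mathcomp Require Import all_boot all_algebra all_field.

Set Implicit Arguments.
Unset Strict Implicit.
Unset Printing Implicit Defensive.

Import GRing.Theory.
Local Open Scope ring_scope.

Section Tensor.
Variable K : fieldType.
Implicit Types U V W : vectType K.

(* U (x) V, written in coordinates; all that is used of it is its universal
   property, see [tlift_tens], [tensorP] and [bilin_tens]. *)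
Definition tensor U V : Type := 'M[K]_(\dim {: U}, \dim {: V}).

HB.instance Definition _ U V := Vector.on (tensor U V).

Definition tens U V (u : U) (v : V) : tensor U V :=
  \matrix_(i, j) (coord (vbasis {: U}) i u * coord (vbasis {: V}) j v).

Definition bilin U V W (f : U -> V -> W) : Prop :=
  (forall v, linear (f^~ v)) /\ (forall u, linear (f u)).

(* The linear map on U (x) V determined by a bilinear map f. *)
Definition tlift U V W (f : U -> V -> W) (t : tensor U V) : W :=
  \sum_i \sum_j t i j *: f (vbasis {: U})`_i (vbasis {: V})`_j.

Section Theory.
Variables U V W : vectType K.

Fact tlift_is_linear (f : U -> V -> W) : linear (tlift f).
Proof.
move=> a s t; rewrite /tlift scaler_sumr -big_split /=; apply: eq_bigr => i _.
rewrite scaler_sumr -big_split /=; apply: eq_bigr => j _.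
by rewrite !mxE scalerDl scalerA.
Qed.
HB.instance Definition _ (f : U -> V -> W) :=
  GRing.isLinear.Build K (tensor U V) W _ (tlift f) (tlift_is_linear f).

Lemma bilin_tens : bilin (@tens U V).
Proof.
split=> w a x y; apply/matrixP=> i j; rewrite !mxE !linearP /=.
  by rewrite mulrDl mulrA.
by rewrite mulrDr mulrCA.
Qed.

Lemma bilin_suml (f : U -> V -> W) : bilin f ->
  forall n (c : 'I_n -> K) (e : 'I_n -> U) v,
  f (\sum_i c i *: e i) v = \sum_i c i *: f (e i) v.
Proof.
move=> [fl _] n c e v.
pose g := HB.pack_for {linear U -> W} (f^~ v)
  (GRing.isLinear.Build K U W _ (f^~ v) (fl v)).
rewrite -[LHS]/(g _) linear_sum; apply: eq_bigr => i _; exact: linearZ.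
Qed.

Lemma bilin_sumr (f : U -> V -> W) : bilin f ->
  forall n (c : 'I_n -> K) (e : 'I_n -> V) u,
  f u (\sum_i c i *: e i) = \sum_i c i *: f u (e i).
Proof.
move=> [_ fr] n c e u.
pose g := HB.pack_for {linear V -> W} (f u)
  (GRing.isLinear.Build K V W _ (f u) (fr u)).
rewrite -[LHS]/(g _) linear_sum; apply: eq_bigr => i _; exact: linearZ.
Qed.

Lemma tlift_tens (f : U -> V -> W) : bilin f ->
  forall u v, tlift f (tens u v) = f u v.
Proof.
move=> fB u v.
rewrite {2}(coord_vbasis (memvf u)) {2}(coord_vbasis (memvf v)).
rewrite (bilin_suml fB); apply: eq_bigr => i _.
rewrite (bilin_sumr fB) scaler_sumr; apply: eq_bigr => j _.
by rewrite mxE scalerA.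
Qed.

Lemma eq_tlift (f g : U -> V -> W) : f =2 g -> tlift f =1 tlift g.
Proof. by move=> fg t; do 2!apply: eq_bigr => ? _; rewrite fg. Qed.

End Theory.

Lemma linear_tlift U V W W' (h : {linear W -> W'}) (f : U -> V -> W) t :
  h (tlift f t) = tlift (fun u v => h (f u v)) t.
Proof.
by rewrite linear_sum; apply: eq_bigr => i _; rewrite linear_sum;
  apply: eq_bigr => j _; rewrite linearZ.
Qed.

Lemma tens_basis U V (i : 'I_(\dim {: U})) (j : 'I_(\dim {: V})) :
  tens (vbasis {: U})`_i (vbasis {: V})`_j = delta_mx i j.
Proof.
apply/matrixP=> k l; rewrite !mxE !coord_free ?(basis_free (vbasisP _)) //.
by rewrite -natrM mulnb (eq_sym i) (eq_sym j).
Qed.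

Lemma tlift_id U V (t : tensor U V) : tlift (@tens U V) t = t.
Proof.
rewrite [RHS]matrix_sum_delta /tlift.
by apply: eq_bigr => i _; apply: eq_bigr => j _; rewrite tens_basis.
Qed.

Lemma tensorP U V W (f g : {linear tensor U V -> W}) :
  (forall u v, f (tens u v) = g (tens u v)) -> f =1 g.
Proof.
by move=> fg t; rewrite -[t]tlift_id !linear_tlift; apply: eq_tlift.
Qed.

Definition tmap U V U' V' (f : 'Hom(U, U')) (g : 'Hom(V, V')) :
  'Hom(tensor U V, tensor U' V') := linfun (tlift (fun u v => tens (f u) (g v))).

(* (u (x) v) (x) w |-> u (x) (v (x) w) *)
Definition tassoc U V W : 'Hom(tensor (tensor U V) W, tensor U (tensor V W)) :=
  linfun (tlift (fun s w => tlift (fun u v => tens u (tens v w)) s)).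

Lemma bilin_comp U V U' V' W (f : U' -> V' -> W)
    (p : {linear U -> U'}) (q : {linear V -> V'}) :
  bilin f -> bilin (fun u v => f (p u) (q v)).
Proof.
by move=> [fl fr]; split=> w a x y; rewrite /= linearP ?fl ?fr.
Qed.

Lemma tmapE U V U' V' (f : 'Hom(U, U')) (g : 'Hom(V, V')) u v :
  tmap f g (tens u v) = tens (f u) (g v).
Proof. by rewrite lfunE /= tlift_tens //; apply/bilin_comp/bilin_tens. Qed.

Lemma tlift_bilinr U V W W' (f : U -> V -> W -> W') (t : tensor U V) :
  (forall u v, linear (f u v)) -> linear (fun w => tlift (fun u v => f u v w) t).
Proof.
move=> fl a x y; rewrite /tlift scaler_sumr -big_split; apply: eq_bigr => i _.
rewrite scaler_sumr -big_split; apply: eq_bigr => j _ /=.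
by rewrite fl scalerDr !scalerA mulrC.
Qed.

Lemma tassocE U V W (u : U) (v : V) (w : W) :
  tassoc U V W (tens (tens u v) w) = tens u (tens v w).
Proof.
rewrite lfunE /= tlift_tens; first last.
  split=> [x|t]; first exact: linearP.
  apply: tlift_bilinr => x y a z z'.
  by rewrite (bilin_tens _ _).2 (bilin_tens _ _).2.
rewrite tlift_tens //; split=> x a y z.
  by rewrite (bilin_tens _ _).1.
by rewrite (bilin_tens _ _).1 (bilin_tens _ _).2.
Qed.

(* The multiplication (x (x) y) (x' (x) y') = x x' (x) y y' of A (x) A. *)
Definition tmul (A : falgType K) (s t : tensor A A) : tensor A A :=
  tlift (fun x y => tlift (fun x' y' => tens (x * x') (y * y')) t) s.

End Tensor.

HB.mixin Record isHopf (K : fieldType) H of Falgebra K H := {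
  comul : 'Hom(H, tensor H H);
  counit : 'Hom(H, K^o);
  antipode : 'End(H);
  comulA : forall h : H,
    tassoc H H H (tmap comul \1 (comul h)) = tmap \1 comul (comul h);
  counitl : forall h : H, tlift (fun x y => (counit x : K) *: y) (comul h) = h;
  counitr : forall h : H, tlift (fun x y => (counit y : K) *: x) (comul h) = h;
  comul1 : comul 1 = tens 1 1;
  comulM : forall g h : H, comul (g * h) = tmul (comul g) (comul h);
  counit1 : counit 1 = 1;
  counitM : forall g h : H, counit (g * h) = counit g * counit h;
  antipodel : forall h : H,
    tlift (fun x y => antipode x * y) (comul h) = (counit h : K) *: 1;
  antipoder : forall h : H,
    tlift (fun x y => x * antipode y) (comul h) = (counit h : K) *: 1
}.

#[short(type="hopfType")]
HB.structure Definition Hopf (K : fieldType) := {H of isHopf K H & Falgebra K H}.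

Section HopfTheory.
Variables (K : fieldType) (H : hopfType K).
Implicit Types g h x y : H.

(* sweedler f h is the sum of f h_(1) h_(2), for f bilinear. *)
Definition sweedler (W : vectType K) (f : H -> H -> W) (h : H) : W :=
  tlift f (comul h).

Lemma exchange_tlift (U V U' V' W : vectType K)
    (F : U -> V -> U' -> V' -> W) s t :
  tlift (fun u v => tlift (F u v) t) s =
  tlift (fun u' v' => tlift (fun u v => F u v u' v') s) t.
Proof.
have G (W1 W2 : vectType K) (r : tensor W1 W2) (f : W1 -> W2 -> W) :
  tlift f r = \sum_p r p.1 p.2 *: f (vbasis {: W1})`_p.1 (vbasis {: W2})`_p.2.
  by rewrite /tlift pair_bigA.
rewrite !G; under eq_bigr do rewrite G scaler_sumr.
rewrite exchange_big; apply: eq_bigr => j _ /=.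
rewrite G scaler_sumr; apply: eq_bigr => i _.
by rewrite !scalerA mulrC.
Qed.

Lemma tlift_tmap (U V U' V' W : vectType K) (F : U' -> V' -> W)
    (f : 'Hom(U, U')) (g : 'Hom(V, V')) t :
  bilin F -> tlift F (tmap f g t) = tlift (fun u v => F (f u) (g v)) t.
Proof.
move=> FB; rewrite lfunE /= linear_tlift.
by apply: eq_tlift => u v /=; rewrite tlift_tens.
Qed.

Lemma sweedlerA (W : vectType K) (F : H -> H -> H -> W) h :
  (forall x y, linear (F x y)) -> (forall x z, linear (fun y => F x y z)) ->
  (forall y z, linear (fun x => F x y z)) ->
  sweedler (fun x y => sweedler (fun p q => F p q y) x) h =
  sweedler (fun x y => sweedler (fun p q => F x p q) y) h.
Proof.
move=> F3 F2 F1.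
have FB x : bilin (F x) by split=> [z|y]; [exact: F2 | exact: F3].
have LB : bilin (fun x s => tlift (F x) s).
  split=> [s|x]; last exact: linearP.
  move=> a x y.
  exact: (@tlift_bilinr _ _ _ _ _ (fun u v w => F w u v)).
have LB' : bilin (fun s z => tlift (fun x y => F x y z) s).
  split=> [z|s]; first exact: linearP.
  move=> a x y.
  exact: (@tlift_bilinr _ _ _ _ _ (fun u v w => F u v w)).
have := congr1 (tlift (fun x s => tlift (F x) s)) (comulA h).
rewrite tlift_tmap // [tassoc _ _ _ _]lfunE /= linear_tlift /sweedler => E.
transitivity (tlift (fun s z => tlift (fun x y => F x y z) s)
  (tmap (@comul _ H) \1%VF (comul h))).
  by rewrite tlift_tmap //; apply: eq_tlift => x y; rewrite id_lfunE.
transitivity (tlift (fun u v => tlift (F (\1%VF u)) (comul v)) (comul h));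
  last by apply: eq_tlift => x y; rewrite id_lfunE.
rewrite -E; apply: eq_tlift => s z; rewrite linear_tlift; apply: eq_tlift => x y.
by rewrite /= !tlift_tens.
Qed.

Lemma sweedler_mulr (f : H -> H -> H) (b h : H) :
  sweedler f h * b = sweedler (fun x y => f x y * b) h.
Proof.
rewrite /sweedler /tlift mulr_suml; apply: eq_bigr => i _.
by rewrite mulr_suml; apply: eq_bigr => j _; rewrite scalerAl.
Qed.

Lemma sweedler_mull (f : H -> H -> H) (b h : H) :
  b * sweedler f h = sweedler (fun x y => b * f x y) h.
Proof.
rewrite /sweedler /tlift mulr_sumr; apply: eq_bigr => i _.
by rewrite mulr_sumr; apply: eq_bigr => j _; rewrite scalerAr.
Qed.

Lemma antipode_uniq (phi : {linear H -> H}) (c : H) :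
  (forall x, sweedler (fun p q => phi p * q) x = (counit x : K) *: c) ->
  forall x, phi x = c * antipode x.
Proof.
move=> phiE x.
transitivity
  (sweedler (fun p q => sweedler (fun u v => phi p * u * antipode v) q) x).
  rewrite -{1}(counitr x) linear_tlift; apply: eq_tlift => p q.
  have -> : sweedler (fun u v => phi p * u * antipode v) q =
            phi p * sweedler (fun u v => u * antipode v) q.
    by rewrite sweedler_mull; apply: eq_tlift => u v; rewrite mulrA.
  by rewrite /sweedler antipoder linearZ /= -scalerAr mulr1.
rewrite -sweedlerA.
- rewrite -{2}(counitl x) linear_tlift sweedler_mull; apply: eq_tlift => p q.
  rewrite -(sweedler_mulr (fun u v => phi u * v)) phiE.
  by rewrite -scalerAl linearZ /= -scalerAr.
- by move=> p q a u v; rewrite linearP mulrDr scalerAr.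
- by move=> p q a u v; rewrite mulrDr mulrDl -scalerAr -scalerAl.
- by move=> p q a u v; rewrite linearP !mulrDl -!scalerAl.
Qed.

Lemma antipodeM g h : antipode (g * h) = antipode h * antipode g.
Proof.
pose phi := linfun ((@antipode _ H) \o amulr h).
have phiE z : phi z = antipode (z * h) by rewrite lfunE /= lfunE.
suff E x : sweedler (fun p q => phi p * q) x = (counit x : K) *: antipode h.
  by rewrite -phiE (antipode_uniq E).
have psi_lin : linear (fun z => sweedler (fun p q => antipode (p * z) * q) x).
  apply: (@tlift_bilinr _ _ _ _ _ (fun p q z => antipode (p * z) * q)).
  move=> u v a y z.
  by rewrite mulrDr -scalerAr linearP mulrDl -scalerAl.
pose psi : {linear H -> H} := HB.pack
  (fun z : H => sweedler (fun p q => antipode (p * z) * q) x)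
  (GRing.isLinear.Build K H H _ _ psi_lin).
transitivity (psi h); first by apply: eq_tlift => p q; rewrite phiE.
rewrite (@antipode_uniq psi ((counit x : K) *: 1)) => [|y].
  by rewrite -scalerAl mul1r.
have mulB : bilin (fun p q : H => antipode p * q).
  split=> [v|u] a p q; first by rewrite linearP mulrDl scalerAl.
  by rewrite mulrDr scalerAr.
rewrite scalerA -[_ * _](counitM y x).
rewrite [LHS](_ : _ = sweedler (fun p q => antipode p * q) (x * y)).
  by rewrite /sweedler antipodel !counitM mulrC.
rewrite /sweedler comulM /tmul linear_tlift.
under [RHS]eq_tlift do rewrite linear_tlift.
rewrite exchange_tlift; apply: eq_tlift => u v.
rewrite (sweedler_mulr (fun p q => antipode (p * u) * q)).
by apply: eq_tlift => p q /=; rewrite tlift_tens // mulrA.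
Qed.

Lemma antipode1 : antipode (1 : H) = 1.
Proof.
have := antipodel (1 : H); rewrite comul1 counit1 scale1r tlift_tens ?mulr1 //.
split=> [y|x] a u v; first by rewrite linearP mulrDl scalerAl.
by rewrite mulrDr scalerAr.
Qed.
End HopfTheory.

Section LinearMaps.
Variables (K : fieldType) (U V W : vectType K).

Definition linfun2 (f : U -> V -> W) : 'Hom(U, 'Hom(V, W)) :=
  linfun (fun u => linfun (f u)).

Lemma linfun_linear (f : U -> V) : linear f -> linfun f =1 f.
Proof.
move=> fl.
exact: (lfunE (HB.pack_for {linear U -> V} f (GRing.isLinear.Build K U V _ f fl))).
Qed.
End LinearMaps.

Lemma linfun2E (K : fieldType) (U V W : vectType K) (f : U -> V -> W) :
  bilin f -> forall u v, linfun2 f u v = f u v.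
Proof.
move=> [fl fr] u v; rewrite linfun_linear; first by rewrite linfun_linear.
move=> a x y; apply/lfunP=> w; rewrite add_lfunE scale_lfunE.
by rewrite !linfun_linear // fl.
Qed.

Lemma bilin_tmap (K : fieldType) (U V U' V' : vectType K) :
  bilin (@tmap K U V U' V').
Proof.
split=> h a f g; apply/lfunP; apply: tensorP => u v /=.
  by rewrite add_lfunE scale_lfunE !tmapE add_lfunE scale_lfunE (bilin_tens _ _).1.
by rewrite add_lfunE scale_lfunE !tmapE add_lfunE scale_lfunE (bilin_tens _ _).2.
Qed.

Lemma tmap1 (K : fieldType) (U V : vectType K) :
  tmap \1 \1 = \1%VF :> 'End(tensor U V).
Proof. by apply/lfunP; apply: tensorP => u v /=; rewrite tmapE !id_lfunE. Qed.

Lemma tmap_comp (K : fieldType) (U V U' V' U2 V2 : vectType K)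
    (f' : 'Hom(U', U2)) (g' : 'Hom(V', V2)) (f : 'Hom(U, U')) (g : 'Hom(V, V')) :
  tmap (f' \o f) (g' \o g) = (tmap f' g' \o tmap f g)%VF.
Proof.
by apply/lfunP; apply: tensorP => u v /=; rewrite !(tmapE, comp_lfunE).
Qed.

Record hmod (K : fieldType) (H : hopfType K) := Hmod {
  hmod_sort :> vectType K;
  act : 'Hom(H, 'End(hmod_sort));
  act1 : act 1 = \1%VF;
  actM : forall g h, act (g * h) = (act g \o act h)%VF
}.

Section ModuleCategory.
Variables (K : fieldType) (H : hopfType K).
Implicit Types X Y : hmod H.

Definition hmod_hom X Y (f : 'Hom(X, Y)) : Prop :=
  forall h, (f \o act X h = act Y h \o f)%VF.

Definition hmod_iso X Y (f : 'Hom(X, Y)) : Prop :=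
  hmod_hom f /\ exists f' : 'Hom(Y, X),
    [/\ hmod_hom f', (f' \o f = \1)%VF & (f \o f' = \1)%VF].

(* h (x (x) y) = h_(1) x (x) h_(2) y *)
Definition tensor_act X Y : 'Hom(H, 'End(tensor X Y)) :=
  linfun (sweedler (fun a b => tmap (act X a) (act Y b))).

Fact tensor_act_bilin X Y : bilin (fun a b => tmap (act X a) (act Y b)).
Proof. exact/bilin_comp/bilin_tmap. Qed.

Fact tensor_actE X Y h :
  tensor_act X Y h = sweedler (fun a b => tmap (act X a) (act Y b)) h.
Proof.
rewrite linfun_linear // => a x y.
by rewrite /sweedler linearP /= linearP.
Qed.

Fact tensor_act1 X Y : tensor_act X Y 1 = \1%VF.
Proof.
rewrite tensor_actE /sweedler comul1 tlift_tens ?act1 ?tmap1 //.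
exact: tensor_act_bilin.
Qed.

Fact tensor_actM X Y g h :
  tensor_act X Y (g * h) = (tensor_act X Y g \o tensor_act X Y h)%VF.
Proof.
rewrite !tensor_actE /sweedler comulM /tmul linear_tlift.
apply/lfunP=> t; rewrite comp_lfunE.
have ev (U V W Z : vectType K) (f : U -> V -> 'Hom(W, Z)) (s : tensor U V) w :
  tlift f s w = tlift (fun u v => f u v w) s.
  rewrite /tlift sum_lfunE; apply: eq_bigr => i _.
  by rewrite sum_lfunE; apply: eq_bigr => j _; rewrite scale_lfunE.
rewrite !ev; apply: eq_tlift => a b; rewrite /= linear_tlift !ev linear_tlift.
apply: eq_tlift => c d /=; rewrite tlift_tens; last exact: tensor_act_bilin.
by rewrite !actM tmap_comp comp_lfunE.
Qed.

Definition hmod_tensor X Y : hmod H :=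
  Hmod (@tensor_act1 X Y) (@tensor_actM X Y).

Section Character.
Variable chi : 'Hom(H, K^o).
Hypotheses (chi1 : chi 1 = 1) (chiM : forall g h, chi (g * h) = chi g * chi h).

Definition char_act : 'Hom(H, 'End(K^o)) :=
  linfun2 (fun h (c : K^o) => chi h * c : K^o).

Fact char_actE h c : char_act h c = chi h * c.
Proof.
rewrite linfun2E //; split=> [x|x] a y z; first by rewrite linearP mulrDl -scalerAl.
by rewrite mulrDr scalerAr.
Qed.

Fact char_act1 : char_act 1 = \1%VF.
Proof. by apply/lfunP=> c; rewrite char_actE chi1 mul1r id_lfunE. Qed.

Fact char_actM g h : char_act (g * h) = (char_act g \o char_act h)%VF.
Proof. by apply/lfunP=> c; rewrite comp_lfunE !char_actE chiM mulrA. Qed.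

Definition char_mod : hmod H := Hmod char_act1 char_actM.
End Character.

Definition hmod_unit : hmod H := char_mod (@counit1 _ H) (@counitM _ H).

(* The left dual X^*, with (h p)(x) = p (S(h) x). *)
Definition dual_act X : 'Hom(H, 'End('Hom(X, K^o))) :=
  linfun2 (fun h (p : 'Hom(X, K^o)) => (p \o act X (antipode h))%VF).

Fact dual_actE X h p : dual_act X h p = (p \o act X (antipode h))%VF.
Proof.
rewrite linfun2E //; split=> [q|g] a x y; apply/lfunP=> z.
  by rewrite !(comp_lfunE, linearP, add_lfunE, scale_lfunE).
by rewrite !(comp_lfunE, add_lfunE, scale_lfunE).
Qed.

Fact dual_act1 X : dual_act X 1 = \1%VF.
Proof.
by apply/lfunP=> p; rewrite dual_actE antipode1 act1 comp_lfun1r id_lfunE.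
Qed.

Fact dual_actM X g h : dual_act X (g * h) = (dual_act X g \o dual_act X h)%VF.
Proof.
by apply/lfunP=> p; rewrite comp_lfunE !dual_actE antipodeM actM comp_lfunA.
Qed.

Definition hmod_dual X : hmod H := Hmod (@dual_act1 X) (@dual_actM X).

Definition dual_map X Y (f : 'Hom(X, Y)) : 'Hom(hmod_dual Y, hmod_dual X) :=
  linfun (fun p : 'Hom(Y, K^o) => (p \o f)%VF).

Lemma dual_mapE X Y (f : 'Hom(X, Y)) (p : 'Hom(Y, K^o)) :
  dual_map f p = (p \o f)%VF.
Proof.
rewrite linfun_linear // => a q r; apply/lfunP=> x.
by rewrite !(comp_lfunE, add_lfunE, scale_lfunE).
Qed.

Notation "X ^**" := (hmod_dual (hmod_dual X)) (at level 2, format "X ^**").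

(* The canonical isomorphism Y^* (x) X^* -> (X (x) Y)^* of left duals,
   q (x) p |-> (x (x) y |-> p(x) q(y)). *)
Definition dual_tensor X Y :
    'Hom(hmod_tensor (hmod_dual Y) (hmod_dual X), hmod_dual (hmod_tensor X Y)) :=
  linfun (tlift (fun (q : 'Hom(Y, K^o)) (p : 'Hom(X, K^o)) =>
    linfun (tlift (fun x y => p x * q y : K^o)))).

Fact bilin_prod (U V : vectType K) (p : 'Hom(U, K^o)) (q : 'Hom(V, K^o)) :
  bilin (fun u v => p u * q v : K^o).
Proof.
split=> [v|u] a x y; first by rewrite linearP mulrDl scalerAl.
by rewrite linearP mulrDr scalerAr.
Qed.

Lemma dual_tensorE X Y (q : 'Hom(Y, K^o)) (p : 'Hom(X, K^o)) x y :
  (dual_tensor X Y (tens q p) : 'Hom(tensor X Y, K^o)) (tens x y) = p x * q y.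
Proof.
rewrite lfunE /= tlift_tens; first by rewrite lfunE /= tlift_tens //; apply: bilin_prod.
split=> [r|r] a f g; apply/lfunP; apply: tensorP => u v /=;
  rewrite add_lfunE scale_lfunE !lfunE /= !tlift_tens; try exact: bilin_prod;
  rewrite add_lfunE scale_lfunE.
  by rewrite mulrDr scalerAr.
by rewrite mulrDl scalerAl.
Qed.

(* Compatibility with tensor products, j_(X (x) Y) = j_X (x) j_Y, is read through
   the canonical X^** (x) Y^** -> (Y^* (x) X^* )^* <- (X (x) Y)^**. *)
Record pivotal := Pivotal {
  piv :> forall X, 'Hom(X, X^**);
  piv_iso : forall X, hmod_iso (piv X);
  piv_natural : forall X Y (f : 'Hom(X, Y)), hmod_hom f ->
    (piv Y \o f = dual_map (dual_map f) \o piv X)%VF;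
  piv_tensor : forall X Y,
    (dual_map (dual_tensor X Y) \o piv (hmod_tensor X Y) =
     dual_tensor (hmod_dual Y) (hmod_dual X) \o tmap (piv X) (piv Y))%VF
}.

Definition bidual_eval X : 'Hom(X, X^**) :=
  linfun2 (fun x (p : 'Hom(X, K^o)) => p x).

Lemma bidual_evalE X x (p : 'Hom(X, K^o)) :
  (bidual_eval X x : 'Hom('Hom(X, K^o), K^o)) p = p x.
Proof.
rewrite linfun2E //; split=> [q|y] a u v; first exact: linearP.
by rewrite add_lfunE scale_lfunE.
Qed.

(* The inverses X -> 1 (x) X and X -> X (x) 1 of the unit isomorphisms. *)
Definition lunitV X : 'Hom(X, hmod_tensor hmod_unit X) :=
  linfun (fun x => tens (1 : K^o) x).

Definition runitV X : 'Hom(X, hmod_tensor X hmod_unit) :=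
  linfun (fun x => tens x (1 : K^o)).

Lemma lunitVE X x : lunitV X x = tens (1 : K^o) x.
Proof. by rewrite linfun_linear //; apply: (bilin_tens _ _).2. Qed.

Lemma runitVE X x : runitV X x = tens x (1 : K^o).
Proof.
by rewrite (linfun_linear (f := fun x => tens x (1 : K^o))) //;
   apply: (bilin_tens _ _).1.
Qed.

Definition grouplike (g : H) : Prop := g != 0 /\ comul g = tens g g.

(* The coproduct of H^* sends p to (x (x) y |-> p (x y)). *)
Definition dual_grouplike (p : 'Hom(H, K^o)) : Prop :=
  p != 0 /\ forall x y, p (x * y) = p x * p y.

Lemma dual_grouplike1 p : dual_grouplike p -> p 1 = 1.
Proof.
move=> [/lfunPn[x]]; rewrite zero_lfunE => px /(_ x 1).
by rewrite mulr1 -{1}[p x]mulr1 => /(mulfI px).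
Qed.

(* The convolution product, i.e. the product of H^*. *)
Definition conv (p q : 'Hom(H, K^o)) : 'Hom(H, K^o) :=
  linfun (sweedler (fun x y => p x * q y : K^o)).

Definition left_integral (L : H) : Prop :=
  forall h, h * L = (counit h : K) *: L.

Definition dual_right_integral (l : 'Hom(H, K^o)) : Prop :=
  forall p, conv l p = (p 1 : K) *: l.

Definition distinguished_dual (alpha : 'Hom(H, K^o)) : Prop :=
  exists L : H, [/\ L != 0, left_integral L &
    forall h, L * h = (alpha h : K) *: L].

Definition distinguished (g : H) : Prop :=
  exists l : 'Hom(H, K^o), [/\ l != 0, dual_right_integral l &
    forall p, conv p l = (p g : K) *: l].

Section Spherical.
Variables (alpha : 'Hom(H, K^o)) (alphaG : dual_grouplike alpha) (g : H).

(* The inverse of alpha in the group of grouplikes of H^*. *)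
Definition alphaV : 'Hom(H, K^o) := (alpha \o antipode)%VF.

Lemma conv_alphaV : conv alpha alphaV = counit.
Proof.
have aL : linear (sweedler (fun x y => alpha x * alphaV y : K^o)).
  by move=> a x y; rewrite /sweedler linearP /= linearP.
apply/lfunP=> h; rewrite linfun_linear //.
rewrite [LHS](_ : _ = alpha (sweedler (fun x y => x * antipode y) h)).
  by rewrite /sweedler antipoder linearZ /= dual_grouplike1 // -[_ *: _]/(_ * _) mulr1.
rewrite linear_tlift; apply: eq_tlift => x y.
by rewrite comp_lfunE /= alphaG.2.
Qed.

Fact alphaV1 : alphaV 1 = 1.
Proof. by rewrite comp_lfunE antipode1 dual_grouplike1. Qed.

Fact alphaVM x y : alphaV (x * y) = alphaV x * alphaV y.
Proof. by rewrite !comp_lfunE antipodeM alphaG.2 mulrC. Qed.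

Definition distinguished_object : hmod H := char_mod alphaV1 alphaVM.

Local Notation D := distinguished_object.

(* v (x) x |-> g x (x) v, with X^**** identified with X by evaluation *)
Definition radford_iso X : 'Hom(hmod_tensor D X, hmod_tensor X^**^** D) :=
  linfun (tlift (fun (v : D) (x : X) =>
    tens (bidual_eval X^** (bidual_eval X (act X g x))) v)).

Lemma radford_isoE X (v : D) (x : X) :
  radford_iso X (tens v x) =
  tens (bidual_eval X^** (bidual_eval X (act X g x))) v.
Proof.
rewrite lfunE /= tlift_tens //; split=> [y|w] a u z.
  by rewrite (bilin_tens _ _).2.
by rewrite !linearP (bilin_tens _ _).1.
Qed.

Definition spherical (j : pivotal) : Prop :=
  exists2 nu : 'Hom(hmod_unit, D), hmod_iso nu &
    forall X,
      (radford_iso X \o (tmap nu \1 \o lunitV X) =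
       tmap \1 nu \o (runitV X^**^** \o (dual_map (dual_map (j X)) \o j X)))%VF.

Definition spherical_category : Prop := exists j : pivotal, spherical j.

End Spherical.

Definition spiv (g a : H) : Prop :=
  [/\ grouplike a, a ^+ 2 = g &
      forall h, antipode (antipode h) = a * h * a^-1].

End ModuleCategory.

(* Main.v *)
Require Import Defs.
From HB Require Import structures.
From mathcomp Require Import all_boot all_algebra all_field.
From Stdlib Require Import FunctionalExtensionality ProofIrrelevance.

Set Implicit Arguments.
Unset Strict Implicit.
Unset Printing Implicit Defensive.

Import GRing.Theory.
Local Open Scope ring_scope.

(** Naturality forces a pivotal structure to be multiplication by one element.
    A vector x of a module X is the image of 1 under the module map h |-> h x
    from the regular module, so j_X is determined by j_H(1), which is the
    evaluation at a unique a in H (finite-dimensional spaces are reflexive):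
    j_X(x) is the evaluation at a x for every X ([pivotalE]).  The action of h
    on X^** is that of S^2(h) on X, so the properties of j translate one by one
    at the regular module: linearity of j says S^2(h) a = a h
    ([pivotal_elt_comm]), and compatibility with tensor products says that a is
    grouplike, by testing it on 1 (x) 1 ([pivotal_elt_grouplike]).  Conversely
    such an a defines a pivotal structure ([pivotal_of]), and the two
    constructions are mutually inverse.

    Sphericality separates into two independent conditions ([sphericalP]).  An
    isomorphism nu from the unit object to D exists if and only if the
    characters epsilon and alpha^-1 by which H acts on these lines agree, that
    is, alpha = epsilon.  Given any such nu, the scalar nu(1) <> 0 cancels from
    the equation xi_D (nu (x) id) = (id (x) nu) j^** j, whose two sides are
    the actions of g and of a^2; on the regular module this says a^2 = g. *)

Section PivotalElements.
Variables (K : fieldType) (H : hopfType K).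
Implicit Types (X Y : hmod H) (a h : H).

Lemma comp_lfun_eq (U V V' W : vectType K) (f : 'Hom(U, V)) (g : 'Hom(V, W))
    (f' : 'Hom(U, V')) (g' : 'Hom(V', W)) :
  (g \o f = g' \o f')%VF -> forall u, g (f u) = g' (f' u).
Proof. by move=> E u; rewrite -!comp_lfunE E. Qed.

(** * Grouplike elements are invertible *)

Lemma counit_grouplike a : grouplike a -> counit a = 1.
Proof.
move=> [a0 aG]; have := counitl a; rewrite aG tlift_tens; last first.
  split=> [y|x] c u v; first by rewrite linearP scalerDl scalerA.
  by rewrite scalerDr !scalerA mulrC.
move=> E; have: ((counit a : K) - 1) *: a == 0 by rewrite scalerBl E scale1r subrr.
by rewrite scaler_eq0 (negPf a0) orbF subr_eq0 => /eqP.
Qed.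

Lemma grouplike_mulS a : grouplike a -> a * antipode a = 1.
Proof.
move=> aG; have := antipoder a; rewrite counit_grouplike // scale1r aG.2.
rewrite tlift_tens //; split=> [y|x] c u v.
  by rewrite mulrDl scalerAl.
by rewrite linearP mulrDr scalerAr.
Qed.

Lemma grouplike_Smul a : grouplike a -> antipode a * a = 1.
Proof.
move=> aG; have := antipodel a; rewrite counit_grouplike // scale1r aG.2.
rewrite tlift_tens //; split=> [y|x] c u v.
  by rewrite linearP mulrDl scalerAl.
by rewrite mulrDr scalerAr.
Qed.

Lemma grouplike_unit a : grouplike a -> a \is a GRing.unit.
Proof.
move=> aG; apply/unitrP; exists (antipode a).
by rewrite grouplike_Smul // grouplike_mulS.
Qed.

(** * Separating tensors by functionals, and reflexivity *)

Definition coordf (V : vectType K) (i : 'I_(\dim {: V})) : 'Hom(V, K^o) :=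
  linfun (coord (vbasis {: V}) i : V -> K^o).

Lemma coordfE (V : vectType K) (i : 'I_(\dim {: V})) (v : V) :
  coordf i v = coord (vbasis {: V}) i v.
Proof. exact: lfunE. Qed.

(** The functionals q (x) p built from coordinate forms read off the matrix
    entries by which tensors are represented. *)
Lemma dual_tensor_inj X Y (s t : tensor X Y) :
  (forall (p : 'Hom(X, K^o)) (q : 'Hom(Y, K^o)),
    (dual_tensor X Y (tens q p) : 'Hom(tensor X Y, K^o)) s =
    (dual_tensor X Y (tens q p) : 'Hom(tensor X Y, K^o)) t) -> s = t.
Proof.
move=> st; apply/matrixP=> i j.
have entry_lin : linear (fun r : tensor X Y => (r i j : K^o)).
  by move=> c r r'; rewrite !mxE.
pose entry := HB.pack_for {linear tensor X Y -> K^o} (fun r : tensor X Y => (r i j : K^o))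
  (GRing.isLinear.Build K (tensor X Y) K^o _ _ entry_lin).
have E : (dual_tensor X Y (tens (coordf j) (coordf i)) : 'Hom(tensor X Y, K^o)) =1 entry.
  apply: tensorP => x y.
  apply: etrans (dual_tensorE (coordf j) (coordf i) x y) _.
  by rewrite !coordfE /= mxE.
by have := st (coordf i) (coordf j); rewrite !E.
Qed.

(** The value at phi is the sum of phi(e^i) e_i over a basis e and its dual
    basis, which is the vector that phi evaluates at. *)
Definition bidual_inv X : 'Hom(hmod_dual (hmod_dual X), X) :=
  linfun (fun phi : 'Hom('Hom(X, K^o), K^o) =>
    \sum_i phi (coordf i) *: (vbasis {: X})`_i).

Lemma bidual_invE X (phi : 'Hom('Hom(X, K^o), K^o)) :
  bidual_inv X phi = \sum_i phi (coordf i) *: (vbasis {: X})`_i.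
Proof.
rewrite (linfun_linear (f := fun phi : 'Hom('Hom(X, K^o), K^o) =>
    \sum_i phi (coordf i) *: (vbasis {: X})`_i)) // => c p q.
rewrite scaler_sumr -big_split; apply: eq_bigr => i _ /=.
by rewrite add_lfunE scale_lfunE scalerDl scalerA.
Qed.

Lemma bidual_evalK X : cancel (bidual_eval X) (bidual_inv X).
Proof.
move=> x; rewrite bidual_invE [RHS](coord_vbasis (memvf x)).
by apply: eq_bigr => i _; rewrite bidual_evalE coordfE.
Qed.

Lemma bidual_invK X : cancel (bidual_inv X) (bidual_eval X).
Proof.
move=> phi; apply/lfunP=> p; rewrite bidual_evalE bidual_invE linear_sum.
transitivity ((phi : 'Hom('Hom(X, K^o), K^o))
   (\sum_(i < \dim {: X}) (p (vbasis {: X})`_i : K) *: coordf i)).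
  rewrite linear_sum; apply: eq_bigr => i _ /=; rewrite !linearZ.
  exact: mulrC.
congr (fun_of_lfun _ _); apply/lfunP=> x.
rewrite sum_lfunE {2}(coord_vbasis (memvf x)) linear_sum.
apply: eq_bigr => i _; rewrite scale_lfunE coordfE linearZ.
exact: mulrC.
Qed.

Lemma act_dual_apply X h (p : 'Hom(X, K^o)) (x : X) :
  (act (hmod_dual X) h p : 'Hom(X, K^o)) x = p (act X (antipode h) x).
Proof. by rewrite -[RHS]comp_lfunE -dual_actE. Qed.

Lemma dual_map_apply X Y (f : 'Hom(X, Y)) (p : 'Hom(Y, K^o)) (x : X) :
  (dual_map f p : 'Hom(X, K^o)) x = p (f x).
Proof. by rewrite dual_mapE comp_lfunE. Qed.

(** Each dualization inserts one antipode, so the identification of X with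
    X^** twists the action by S^2; hence the commutation rule for the
    elements that give pivotal structures. *)
Lemma bidual_eval_act X h (x : X) :
  act (hmod_dual (hmod_dual X)) h (bidual_eval X x) =
  bidual_eval X (act X (antipode (antipode h)) x).
Proof.
apply/lfunP=> p; rewrite bidual_evalE.
apply: etrans (act_dual_apply (X := hmod_dual X) _ _ _) _.
by rewrite bidual_evalE; apply: act_dual_apply.
Qed.

Lemma bidual_eval_natural X Y (f : 'Hom(X, Y)) (x : X) :
  dual_map (dual_map f) (bidual_eval X x) = bidual_eval Y (f x).
Proof.
apply/lfunP=> p; rewrite bidual_evalE.
apply: etrans (dual_map_apply (dual_map f) _ _) _.
by rewrite bidual_evalE; apply: dual_map_apply.
Qed.

Lemma hmod_iso_cancel X Y (f : 'Hom(X, Y)) (f' : 'Hom(Y, X)) :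
  hmod_hom f -> cancel f f' -> cancel f' f -> hmod_iso f.
Proof.
move=> fH fK f'K; split=> //; exists f'; split.
- move=> h; apply/lfunP=> y; rewrite !comp_lfunE; apply: (can_inj fK).
  by have := comp_lfun_eq (fH h) (f' y); rewrite !f'K => ->.
- by apply/lfunP=> x; rewrite comp_lfunE id_lfunE fK.
- by apply/lfunP=> x; rewrite comp_lfunE id_lfunE f'K.
Qed.

(** * The regular module *)

Fact regular_act1 : linfun (@amull K H) 1 = \1%VF.
Proof. by apply/lfunP=> x; rewrite !lfunE /= mul1r. Qed.

Fact regular_actM g h :
  linfun (@amull K H) (g * h) = (linfun (@amull K H) g \o linfun (@amull K H) h)%VF.
Proof. by apply/lfunP=> x; rewrite comp_lfunE !lfunE /= mulrA. Qed.

Definition regular : hmod H := Hmod regular_act1 regular_actM.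

Lemma regular_actE h (x : regular) : act regular h x = h * x :> H.
Proof. by rewrite /= !lfunE. Qed.

(** Naturality along these maps is what pins down a pivotal structure. *)
Definition orbit_map X (x : X) : 'Hom(regular, X) :=
  linfun (fun h : H => act X h x).

Lemma orbit_mapE X (x : X) h : orbit_map x h = act X h x.
Proof.
rewrite linfun_linear // => c u v.
by rewrite linearP add_lfunE scale_lfunE.
Qed.

Lemma orbit_map_hom X (x : X) : hmod_hom (orbit_map x).
Proof.
move=> h; apply/lfunP=> k; rewrite !comp_lfunE !orbit_mapE regular_actE.
by rewrite actM comp_lfunE.
Qed.

(** * The element of a pivotal structure *)

Definition pivotal_elt (j : pivotal H) : H := bidual_inv regular (j regular 1).

(** Naturality along the module map H -> X that sends 1 to x transports
    j_H(1), the evaluation at [pivotal_elt j], to j_X(x). *)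
Lemma pivotalE (j : pivotal H) X (x : X) :
  j X x = bidual_eval X (act X (pivotal_elt j) x).
Proof.
have := comp_lfun_eq (piv_natural j (orbit_map_hom x)) ((1 : H) : regular).
rewrite orbit_mapE act1 id_lfunE => ->.
rewrite -[j regular _]bidual_invK.
apply: etrans (bidual_eval_natural _ _) _.
by rewrite orbit_mapE.
Qed.

(** Both sides are the value at h of the H-linear map j_H, read in H: as the
    image of h 1, and as h acting, through S^2, on the image of 1. *)
Lemma pivotal_elt_comm (j : pivotal H) h :
  antipode (antipode h) * pivotal_elt j = pivotal_elt j * h.
Proof.
have [jH _] := piv_iso j regular.
have E := comp_lfun_eq (jH h) ((1 : H) : regular).
have {E} := etrans (etrans (esym (pivotalE j _)) E) (congr1 _ (pivotalE j _)).
move=> E; have {E} := etrans E (bidual_eval_act _ _).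
move/(can_inj (@bidual_evalK regular)).
by rewrite !regular_actE !mulr1.
Qed.

Lemma act_tensorE X Y h (x : X) (y : Y) :
  act (hmod_tensor X Y) h (tens x y) =
  tlift (fun b c => tens (act X b x) (act Y c y)) (comul h).
Proof.
rewrite /= tensor_actE /sweedler /tlift sum_lfunE.
apply: eq_bigr => i _; rewrite sum_lfunE; apply: eq_bigr => k _.
by rewrite scale_lfunE tmapE.
Qed.

Lemma act_grouplike_tensor X Y a (x : X) (y : Y) : grouplike a ->
  act (hmod_tensor X Y) a (tens x y) = tens (act X a x) (act Y a y).
Proof.
move=> [_ aG]; rewrite act_tensorE aG tlift_tens //.
split=> [c|b] k u v; rewrite linearP add_lfunE scale_lfunE.
  exact: (bilin_tens _ _).1.
exact: (bilin_tens _ _).2.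
Qed.

(** Testing on 1 (x) 1 recovers the whole coproduct from the tensor product of
    two regular modules. *)
Lemma comul_regular h :
  act (hmod_tensor regular regular) h (tens ((1 : H) : regular) ((1 : H) : regular)) =
  comul h.
Proof.
rewrite act_tensorE -[RHS]tlift_id; apply: eq_tlift => x y.
by rewrite !regular_actE !mulr1.
Qed.

(** Nonzero because j_H is injective.  At 1 (x) 1, the two sides of the tensor
    compatibility evaluate functionals at comul a and at a (x) a. *)
Lemma pivotal_elt_grouplike (j : pivotal H) : grouplike (pivotal_elt j).
Proof.
split.
  apply/eqP=> j0; have [_ [k [_ kj _]]] := piv_iso j regular.
  have := comp_lfun_eq (etrans kj (esym (comp_lfun1l _))) ((1 : H) : regular).
  rewrite pivotalE regular_actE j0 mul0r !linear0 !id_lfunE.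
  by move/esym/eqP; rewrite oner_eq0.
apply: (@dual_tensor_inj regular regular) => p q.
have := comp_lfun_eq (piv_tensor j regular regular)
  (tens ((1 : H) : regular) ((1 : H) : regular)).
rewrite tmapE !pivotalE !regular_actE !mulr1 comul_regular.
move/(congr1 (fun F : 'Hom(tensor 'Hom(H, K^o) 'Hom(H, K^o), K^o) => F (tens q p))).
have L := etrans (dual_map_apply (dual_tensor regular regular)
  (bidual_eval (hmod_tensor regular regular) (comul (pivotal_elt j))) (tens q p))
  (bidual_evalE _ _).
move=> E; apply: etrans (esym L) _; apply: etrans E _.
apply: etrans (dual_tensorE (X := hmod_dual regular) (Y := hmod_dual regular) _ _ _ _) _.
rewrite !bidual_evalE mulrC.
exact/esym/(dual_tensorE (X := regular) (Y := regular)).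
Qed.

(** * The pivotal structure of an element *)

Definition pivotal_element a : Prop :=
  grouplike a /\ forall h, antipode (antipode h) = a * h * a^-1.

Lemma pivotal_elementP (j : pivotal H) : pivotal_element (pivotal_elt j).
Proof.
split=> [|h]; first exact: pivotal_elt_grouplike.
by rewrite -pivotal_elt_comm mulrK // grouplike_unit //; apply: pivotal_elt_grouplike.
Qed.

Section OfElement.
Variables (a : H) (aP : pivotal_element a).

Definition piv_of X : 'Hom(X, hmod_dual (hmod_dual X)) :=
  (bidual_eval X \o act X a)%VF.

Lemma piv_ofE X x : piv_of X x = bidual_eval X (act X a x).
Proof. exact: comp_lfunE. Qed.

Fact piv_of_hom X : hmod_hom (piv_of X).
Proof.
move=> h; apply/lfunP=> x; rewrite !comp_lfunE bidual_eval_act.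
rewrite -[act X a _]comp_lfunE -[act X (antipode _) _]comp_lfunE -!actM.
by rewrite aP.2 divrK //; apply/grouplike_unit/aP.1.
Qed.

Fact piv_of_iso X : hmod_iso (piv_of X).
Proof.
have aU := grouplike_unit aP.1.
apply: (hmod_iso_cancel (f' := (act X (a^-1)%R \o bidual_inv X)%VF)).
- exact: piv_of_hom.
- move=> x; rewrite piv_ofE comp_lfunE bidual_evalK -comp_lfunE -actM mulVr //.
  by rewrite act1 id_lfunE.
- move=> x; rewrite piv_ofE comp_lfunE -[act X a _]comp_lfunE -actM mulrV //.
  by rewrite act1 id_lfunE bidual_invK.
Qed.

Fact piv_of_natural X Y (f : 'Hom(X, Y)) : hmod_hom f ->
  (piv_of Y \o f = dual_map (dual_map f) \o piv_of X)%VF.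
Proof.
move=> fH; apply/lfunP=> x; rewrite !comp_lfunE bidual_eval_natural.
by rewrite -[act Y a _]comp_lfunE -fH comp_lfunE.
Qed.

Lemma piv_of_tens X Y (x : X) (y : Y) :
  piv_of (hmod_tensor X Y) (tens x y) =
  bidual_eval (hmod_tensor X Y) (tens (act X a x) (act Y a y)).
Proof. by rewrite piv_ofE act_grouplike_tensor //; apply: aP.1. Qed.

Fact piv_of_tensor X Y :
  (dual_map (dual_tensor X Y) \o piv_of (hmod_tensor X Y) =
   dual_tensor (hmod_dual Y) (hmod_dual X) \o tmap (piv_of X) (piv_of Y))%VF.
Proof.
apply/lfunP; apply: tensorP => x y.
rewrite /= [LHS]comp_lfunE [RHS]comp_lfunE.
apply: etrans (congr1 (dual_map (dual_tensor X Y)) (piv_of_tens x y)) _.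
rewrite tmapE !piv_ofE.
apply/lfunP; apply: tensorP => q p.
apply: etrans (dual_map_apply (dual_tensor X Y) _ _) _.
rewrite bidual_evalE dual_tensorE; apply/esym.
apply: etrans (dual_tensorE (X := hmod_dual Y) (Y := hmod_dual X) _ _ _ _) _.
by rewrite !bidual_evalE mulrC.
Qed.

Definition pivotal_of : pivotal H :=
  Pivotal piv_of_iso piv_of_natural piv_of_tensor.

Lemma pivotal_ofK : pivotal_elt pivotal_of = a.
Proof.
apply: etrans (congr1 (bidual_inv regular) (piv_ofE ((1 : H) : regular))) _.
by rewrite bidual_evalK regular_actE mulr1.
Qed.
End OfElement.

(** A pivotal structure is a family of maps with proofs, so equality of the
    families, which [pivotalE] gives pointwise, needs function extensionality
    in the module and proof irrelevance for the rest. *)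
Lemma pivotal_elt_inj : injective pivotal_elt.
Proof.
move=> j k jk.
have E : piv j = piv k.
  by apply: functional_extensionality_dep => X; apply/lfunP=> x; rewrite !pivotalE jk.
case: j k E {jk} => [p p1 p2 p3] [q q1 q2 q3] /= E; subst q.
by congr Pivotal; apply: proof_irrelevance.
Qed.

(** * Sphericality *)

Section Spherical.
Variables (alpha : 'Hom(H, K^o)) (alphaG : dual_grouplike alpha) (g : H).

Lemma conv_counitr (p : 'Hom(H, K^o)) : conv p counit = p.
Proof.
apply/lfunP=> h; rewrite linfun_linear; last first.
  by move=> c x y; rewrite /sweedler linearP /= linearP.
rewrite -[in RHS](counitr h) linear_tlift; apply: eq_tlift => x y.
by rewrite /= linearZ mulrC.
Qed.

Lemma conv_counitl (p : 'Hom(H, K^o)) : conv counit p = p.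
Proof.
apply/lfunP=> h; rewrite linfun_linear; last first.
  by move=> c x y; rewrite /sweedler linearP /= linearP.
rewrite -[in RHS](counitl h) linear_tlift; apply: eq_tlift => x y.
by rewrite /= linearZ.
Qed.

(** The two are mutually inverse for convolution, whose unit is the counit. *)
Lemma alphaV_counit : alphaV alpha = counit <-> alpha = counit.
Proof.
have cE := conv_alphaV alphaG; split=> E; rewrite E in cE.
  by rewrite conv_counitr in cE.
by rewrite conv_counitl E in cE *.
Qed.

Lemma unit_iso_neq0 X (nu : 'Hom(hmod_unit H, X)) : hmod_iso nu -> nu (1 : K^o) != 0.
Proof.
move=> [_ [nu' [_ nuK _]]]; apply/eqP=> nu0.
have := comp_lfun_eq (etrans nuK (esym (comp_lfun1l _))) (1 : K^o).
by rewrite nu0 linear0 !id_lfunE => /esym/eqP; rewrite oner_eq0.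
Qed.

(** H acts on the two lines by the characters epsilon and alpha^-1; an
    isomorphism of lines intertwines them only if they are equal,
    and then the identity does. *)
Lemma unit_iso_distinguished :
  (exists nu : 'Hom(hmod_unit H, distinguished_object alphaG), hmod_iso nu) <->
  alpha = counit.
Proof.
apply: iff_trans alphaV_counit; split=> [[nu nuI]|E].
  have [nuH _] := nuI; apply/lfunP=> h.
  have := comp_lfun_eq (nuH h) (1 : K^o); rewrite /= !char_actE mulr1.
  rewrite -[counit h in LHS]mulr1 -[_ * 1]/((counit h : K) *: (1 : K^o)) linearZ.
  by move/(mulIf (unit_iso_neq0 nuI)).
exists \1%VF; apply: (@hmod_iso_cancel (hmod_unit H) (distinguished_object alphaG) \1%VF \1%VF);
  try by move=> x; rewrite !id_lfunE.
move=> h; apply/lfunP=> c; rewrite !comp_lfunE !id_lfunE /= !char_actE.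
by rewrite E.
Qed.

(** Any isomorphism nu serves: it enters both sides of the spherical equation
    only through the nonzero scalar nu(1). *)
Lemma sphericalP (j : pivotal H) :
  spherical alphaG g j <-> alpha = counit /\ pivotal_elt j ^+ 2 = g.
Proof.
have eqn (nu : 'Hom(hmod_unit H, distinguished_object alphaG)) X x :
    (((radford_iso alphaG g X \o (tmap nu \1 \o lunitV X))%VF x =
    tens (bidual_eval _ (bidual_eval X (act X g x))) (nu (1 : K^o))) *
   ((tmap \1 nu \o (runitV (hmod_dual (hmod_dual (hmod_dual (hmod_dual X))))
      \o (dual_map (dual_map (j X)) \o j X)))%VF x =
    tens (bidual_eval _ (bidual_eval X (act X (pivotal_elt j ^+ 2) x)))
      (nu (1 : K^o))))%type.
  split.
    by rewrite !comp_lfunE lunitVE tmapE radford_isoE id_lfunE.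
  rewrite !comp_lfunE runitVE tmapE id_lfunE pivotalE bidual_eval_natural.
  by rewrite pivotalE expr2 actM comp_lfunE.
split=> [[nu nuI E]|[/unit_iso_distinguished [nu nuI] E]]; last first.
  by exists nu => // X; apply/lfunP=> x; rewrite !eqn E.
split; first by apply/unit_iso_distinguished; exists nu.
have nu1 := unit_iso_neq0 nuI.
have := congr1 (fun f => fun_of_lfun f ((1 : H) : regular)) (E regular).
rewrite !eqn.
(* Multiplying the two factors together turns z (x) nu(1) into nu(1) z. *)
move/(congr1 (tlift (fun z (c : K^o) => (c : K) *: z))).
rewrite !tlift_tens; first last.
- split=> [y|x] c u v; first by rewrite scalerDr !scalerA mulrC.
  by rewrite scalerDl scalerA.
- split=> [y|x] c u v; first by rewrite scalerDr !scalerA mulrC.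
  by rewrite scalerDl scalerA.
move/(scalerI nu1)/(can_inj (@bidual_evalK _))/(can_inj (@bidual_evalK _)).
by rewrite !regular_actE !mulr1.
Qed.

End Spherical.
End PivotalElements.

Theorem proposition3p12 (K : closedFieldType) (H : hopfType K)
    (alpha : 'Hom(H, K^o)) (g : H)
    (alphaG : dual_grouplike alpha) (alphaD : distinguished_dual alpha)
    (gG : grouplike g) (gD : distinguished g) :
  (spherical_category alphaG g <-> alpha = counit /\ exists a : H, spiv g a) /\
  (spherical_category alphaG g ->
     exists f : {j : pivotal H | spherical alphaG g j} -> {a : H | spiv g a},
       bijective f).
Proof.
have spivP j : spherical alphaG g j -> spiv g (pivotal_elt j).
  by move=> /sphericalP[_ jg]; have [jG jS] := pivotal_elementP j.
have spiv_piv a : spiv g a -> pivotal_element a by case.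
have sphericalI (ae : alpha = counit) a (aP : spiv g a) :
    spherical alphaG g (pivotal_of (spiv_piv a aP)).
  by apply/sphericalP; rewrite pivotal_ofK; case: aP.
split; first split.
- by move=> [j jP]; split; [case/sphericalP: jP | exists (pivotal_elt j); apply: spivP].
- by move=> [ae [a aP]]; exists (pivotal_of (spiv_piv a aP)); apply: sphericalI.
case=> j0 /sphericalP[ae _].
exists (fun j => exist _ (pivotal_elt (sval j)) (spivP _ (svalP j))).
exists (fun a => exist _ (pivotal_of (spiv_piv _ (svalP a))) (sphericalI ae _ (svalP a))).
  move=> [j jP]; apply: subset_eq_compat; apply: pivotal_elt_inj.
  by rewrite pivotal_ofK.
by move=> [a aP]; apply: subset_eq_compat; rewrite pivotal_ofK.
Qed.
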